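(* For $n\ge1$ let $\overline m_n'=\sum_{\pi\in S_{NC}^\delta(n,-n)}c^{\#(\pi)/2}$ and $m_n=\sum_{\pi\in NC(n)}c^{\#(\pi)}$, and let $m_0=1$. Then $\overline m_1'=0$ and for all $n\ge2$ $$\overline m_n'=(n-1)m_{n-1}+(c-1)\,\overline m_{n-1}'+2\sum_{k=1}^{n-2}m_{k-1}\,\overline m_{n-k}'.$$
   Context: Here $c>0$ is a parameter (both sides are polynomials in $c$). $NC(n)$ is the set of non-crossing partitions of $[n]=\{1,\dots,n\}$; for a partition $\#(\pi)$ is the number of blocks; for a permutation $\#(\pi)$ is the number of cycles (fixed points included). Let $[\pm n]=\{\pm1,\dots,\pm n\}$ and let $S_{\pm n}$ be its symmetric group (products composed right to left). Let $\delta\in S_{\pm n}$, $\delta(k)=-k$; let $\gamma\in S_{\pm n}$ be the cycle $(1,2,\dots,n)$, acting trivially on negative numbers; put $\tilde\gamma=\gamma\delta\gamma^{-1}\delta=(1,2,\dots,n)(-n,\dots,-2,-1)$. A pairing is a permutation all of whose cycles have length 2. $S_{NC}^\delta(n,-n)$ is the set of $\sigma\in S_{\pm n}$ such that (1) the subgroup $\langle\sigma,\tilde\gamma\rangle$ acts transitively on $[\pm n]$; (2) $\#(\sigma)+\#(\sigma^{-1}\tilde\gamma)=2n$; (3) $\sigma\delta$ is a pairing. *)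

(* Defs.v *)
From mathcomp Require Import all_boot all_order all_algebra all_fingroup.

Set Implicit Arguments.
Unset Strict Implicit.
Unset Printing Implicit Defensive.

Import Order.TTheory GRing.Theory Num.Theory.
Local Open Scope ring_scope.

(* The set [+-n]: (false, i) stands for i + 1 and (true, i) for - (i + 1). *)
Notation pm n := (bool * 'I_n)%type.

(* Products of permutations are composed from right to left here, whereas
   (s * t)%g applies s first. *)
Definition rmulp (T : finType) (s t : {perm T}) : {perm T} := (t * s)%g.
Notation "s '\op' t" := (rmulp s t) (at level 40, left associativity).

Definition ncycles (T : finType) (s : {perm T}) : nat := #|porbits s|.

Definition pairing (T : finType) (s : {perm T}) : bool :=
  [forall C in porbits s, #|C| == 2].

Definition delta_fun (n : nat) (x : pm n) : pm n := (~~ x.1, x.2).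

Lemma delta_fun_inj (n : nat) : injective (@delta_fun n).
Proof. by move=> [a i] [b j] [/negb_inj -> ->]. Qed.

Definition delta (n : nat) : {perm pm n} := perm (@delta_fun_inj n).

Definition gamma_fun (n : nat) (x : pm n) : pm n :=
  if x.1 then x else (false, ordS x.2).

Lemma gamma_fun_inj (n : nat) : injective (@gamma_fun n).
Proof.
by move=> [[] i] [[] j] //= /(congr1 snd) /= /ordS_inj ->.
Qed.

Definition gamma (n : nat) : {perm pm n} := perm (@gamma_fun_inj n).

Definition gammat (n : nat) : {perm pm n} :=
  gamma n \op delta n \op (gamma n)^-1%g \op delta n.

Definition SNCdelta (n : nat) : {set {perm pm n}} :=
  [set s : {perm pm n} |
    [&& [transitive <<[set s; gammat n]>>%g, on [set: pm n] | 'P],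
        (ncycles s + ncycles (s^-1%g \op gammat n) == 2 * n)%N
      & pairing (s \op delta n)]].

Definition noncrossing (n : nat) (P : {set {set 'I_n}}) : bool :=
  [forall B in P, forall C in P,
     [exists i in B, exists j in C, exists k in B, exists l in C,
        [&& (i < j)%N, (j < k)%N & (k < l)%N]] ==> (B == C)].

Definition NC (n : nat) : {set {set {set 'I_n}}} :=
  [set P : {set {set 'I_n}} | partition P [set: 'I_n] & noncrossing P].

(* For n = 0 the sum has the single term given by the empty partition, so that
   ncsum c 0 = 1: see ncsum0. *)
Definition ncsum (R : realFieldType) (c : R) (n : nat) : R :=
  \sum_(P in NC n) c ^+ #|P|.

(* The number of cycles of a member of SNCdelta n is even (ncycles_SNCdelta),
   so the halving is exact. *)
Definition ncdsum (R : realFieldType) (c : R) (n : nat) : R :=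
  \sum_(s in SNCdelta n) c ^+ (ncycles s)./2.

Lemma ncsum0 (R : realFieldType) (c : R) : ncsum c 0 = 1.
Proof.
have T0 : [set: 'I_0] = set0 by apply/setP=> -[].
rewrite /ncsum (bigD1 set0) /=; last first.
  rewrite inE T0 partition_set0 eqxx /=.
  by apply/forall_inP=> B; rewrite inE.
rewrite cards0 expr0 big1 ?addr0 // => P /andP[].
by rewrite inE T0 partition_set0 => /andP[/eqP->]; rewrite eqxx.
Qed.

Lemma even_card_involution (T : finType) (f : T -> T) (A : {set T}) :
  (forall x, x \in A -> [/\ f x \in A, f (f x) = x & f x != x]) ->
  ~~ odd #|A|.
Proof.
have [m] := ubnP #|A|; elim: m A => // m IHm A ltA fA.
have [->|[x xA]] := set_0Vmem A; first by rewrite cards0.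
have [fxA ffx fx] := fA x xA.
have fxA' : f x \in A :\ x by rewrite in_setD1 fx fxA.
rewrite (cardsD1 x) xA (cardsD1 (f x)) fxA' /= negbK.
apply: IHm => [|y].
  by move: ltA; rewrite (cardsD1 x) xA (cardsD1 (f x)) fxA' ltnS; apply: ltnW.
rewrite !in_setD1 => /and3P[yfx yx yA]; have [fyA ffy fy] := fA y yA.
split=> //; rewrite fyA andbT; apply/andP; split.
  by apply: contraNneq yx => e; rewrite -ffy e ffx.
by apply: contraNneq yfx => e; rewrite -e ffy.
Qed.

Lemma pairingP (T : finType) (s : {perm T}) :
  pairing s -> forall x, s (s x) = x /\ s x != x.
Proof.
move=> /forall_inP ps x.
have /ps/eqP c2 : porbit s x \in porbits s by apply: imset_f.
have := iter_porbit s x; rewrite c2 /= => -> ; split=> //.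
by apply/eqP=> sx; have := uniq_traject_porbit s x; rewrite c2 /= sx inE eqxx.
Qed.

Lemma even_ncycles (T : finType) (s d : {perm T}) :
  (forall x, d (d x) = x /\ d x != x) -> pairing (s \op d) ->
  ~~ odd (ncycles s).
Proof.
move=> dd /pairingP sd.
have sdE x : s (d x) = (s \op d) x by rewrite permM.
have sds x : s (d (s x)) = d x.
  by have [+ _] := sd (d x); rewrite -!sdE (proj1 (dd x)).
have sdX i x : (s ^+ i)%g (d ((s ^+ i)%g x)) = d x.
  elim: i x => [|i IHi] x; first by rewrite expg0 !perm1.
  by rewrite {1}expgSr expgS !permM IHi sds.
have dX i x : d ((s ^+ i)%g x) \in porbit s (d x).
  by rewrite porbit_sym -{1}(sdX i x) mem_porbit.
have dporb x y : x \in porbit s y -> porbit s (d x) = porbit s (d y).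
  by case/porbitP=> i ->; apply/eqP; rewrite eq_porbit_mem dX.
have fd x : d @: porbit s x = porbit s (d x).
  apply/setP=> y; apply/imsetP/idP=> [[z zx ->]|].
    by rewrite -(dporb _ _ zx) porbit_id.
  move=> /dporb; rewrite (proj1 (dd x)) => e; exists (d y).
    by rewrite -e porbit_id.
  by rewrite (proj1 (dd y)).
apply: (@even_card_involution _ (fun B : {set T} => d @: B)) => B.
case/imsetP=> x _ ->; split; rewrite !fd ?(proj1 (dd x)) //.
  exact: imset_f.
rewrite eq_porbit_mem; apply/negP=> /porbitP[i].
rewrite -(odd_double_half i) -addnn; set a := i./2.
case: (odd i) => /= dxE.
  have e : s (d ((s ^+ a.+1)%g x)) = (s ^+ a.+1)%g x.
    apply: (@perm_inj _ (s ^+ a)%g).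
    rewrite -permM -expgS sdX dxE -permM -expgD.
    by rewrite addnA.
  by have [_] := sd ((s ^+ a.+1)%g x); rewrite -sdE e eqxx.
have e : d ((s ^+ a)%g x) = (s ^+ a)%g x.
  by apply: (@perm_inj _ (s ^+ a)%g); rewrite sdX dxE -permM -expgD.
by have [_] := dd ((s ^+ a)%g x); rewrite e eqxx.
Qed.

Lemma ncycles_SNCdelta (n : nat) (s : {perm pm n}) :
  s \in SNCdelta n -> ~~ odd (ncycles s).
Proof.
rewrite inE => /and3P[_ _]; apply: even_ncycles => -[b i].
by rewrite !permE /delta_fun /= negbK; split=> //; case: b.
Qed.

(* Main.v *)
Require Import Defs.
From mathcomp Require Import all_boot all_order all_algebra all_fingroup.
From mathcomp Require Import zify ring.

(** A permutation [s] in [SNCdelta n] is determined by the pairing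
    [p = s \op delta].  Next to [p] there are two fixed pairings of the [2n]
    points, [delta] with pairs [{k, -k}] and [epsilon] with pairs
    [{gamma k, -k}]; their union is one cycle through all the points, so that
    [p] is a gluing of the sides of a polygon.  Every loop of [p]
    and [delta] gives two cycles of [s], one for each direction, and the loops
    of [p] and [epsilon] give in the same way the cycles of [s^-1 \op gammat n].
    Hence [p] has at most [n + 1] loops in all, by Euler's formula: [n + 1] when
    the glued surface is a sphere, [n] when it is a projective plane.  The
    second case is the one counted by [ncdsum], because transitivity only says
    that the surface is not orientable, and an orientable one has a number of
    loops of the parity of [n + 1] ([mem_SNCdelta]).  Let [loopgf] be the sum
    over all pairings [p] of [(c X)^i X^j], with [i] loops along [delta] and [j]
    loops along [epsilon].  Then [ncdsum c n] is its coefficient of degree [n]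
    ([ncdsum_coef]), and its coefficient of degree [n + 1] will turn out to be
    [ncsum c n].

    This polynomial is computed by removing the chord of [p] at a fixed point
    [a] ([loopgf_cut]): if [b] is the partner of [a], both points are deleted
    and the edges of [delta] and [epsilon] that ended there are joined
    ([cut]); the only loops that are lost are those formed by the chord and a
    single edge.  The remaining edges form one cycle with two points less if [a]
    and [b] are at even distance ([system_twist]), and two cycles if they are at
    odd distance ([system_split]).  So one has to allow several polygons from
    the start, and then the chord may also join two of them into one
    ([system_merge]).

    For polygons with [2 n_1, ..., 2 n_r] sides and [n] the sum of the [n_i],
    the degree of the loop polynomial is at most [n + r], and its coefficients
    of degree [n + r] and [n + r - 1] are the coefficients of degree 0 and 1 of
    the product of the [M n_i], where the polynomials [M k] are defined by
      [M 0 = 1] and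
      [M (k + 1) = k X M k + c M k + sum_(1 <= j <= k) M j * M (k - j)].
    This is proved by induction along the cuts ([loopgf_topcoef]): a cut that
    splits a polygon preserves the leading degree [n + r], one that shortens it
    lowers it by one, which is the factor [X], and one that joins two polygons
    lowers it by two and does not contribute.  No separate treatment of the
    pairings that respect the polygons is needed: the product formula comes out
    of the induction.

    The constant coefficients of the [M k] satisfy the recursion of the numbers
    [ncsum c k] ([ncsumS]), proved by cutting a non-crossing partition at the
    block of its last element.  The coefficients of degree 1 are therefore the
    numbers [ncdsum c k], and the recursion of the [M k] read in degree 1 is the
    formula to be proved. *)

Set Implicit Arguments.
Unset Strict Implicit.
Unset Printing Implicit Defensive.

Import Order.TTheory GRing.Theory Num.Theory.
Local Open Scope ring_scope.

(** * Cutting a chord out of a pairing *)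

Section Cut.
Variable T : finType.
Implicit Types (A : {set T}) (p D Q s : {perm T}) (a b x y : T).

(** Pairings of a subset [A] of a fixed type, extended by fixed points, so that
    deleting points does not change the type. *)
Definition matching A p : bool :=
  [forall x, (p (p x) == x) && ((p x != x) == (x \in A))].

Lemma matchingP A p :
  reflect ((forall x, p (p x) = x) /\ (forall x, (p x != x) = (x \in A)))
          (matching A p).
Proof.
apply: (iffP forallP) => [h|[h1 h2] x]; last by rewrite h1 h2 !eqxx.
by split=> x; have /andP[/eqP ? /eqP] := h x.
Qed.

Lemma matchingK A p : matching A p -> involutive p.
Proof. by case/matchingP. Qed.

Lemma matching_neq A p x : matching A p -> (p x != x) = (x \in A).
Proof. by case/matchingP. Qed.

Lemma matching_mem A p x : matching A p -> (p x \in A) = (x \in A).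
Proof. by case/matchingP=> pK pA; rewrite -!pA pK eq_sym. Qed.

Lemma matching_out A p x : matching A p -> x \notin A -> p x = x.
Proof. by case/matchingP=> pK pA; rewrite -pA negbK => /eqP. Qed.

Lemma matchingV A p : matching A p -> (p^-1 = p)%g.
Proof. by move=> mp; apply/permP=> x; rewrite -{1}(matchingK mp x) permK. Qed.

(** Deleting [a] and [b] from [D] and joining the two edges that ended there
    into the edge [{D a, D b}].  Conjugation by [tperm b (D a)] exchanges the ends
    of these edges, giving [{a, b}] and [{D a, D b}]; the last factor removes the
    edge [{a, b}].  If [D a = b] the conjugation is trivial and the edge [{a, b}]
    is just dropped. *)
Definition cut a b D : {perm T} :=
  (tperm b (D a) * D * tperm b (D a) * tperm a b)%g.

Lemma cutE A D a b x : matching A D -> a \in A -> b \in A -> a != b ->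
  cut a b D x = if (x == a) || (x == b) then x
                else if D x == a then D b else if D x == b then D a else D x.
Proof.
move=> mD aA bA nab; have DK := matchingK mD.
have Da : D a != a by rewrite (matching_neq _ mD).
have Db : D b != b by rewrite (matching_neq _ mD).
have swap u v : (D u == v) = (u == D v) by rewrite -{1}(DK v) (inj_eq perm_inj).
rewrite /cut !permM.
have [->|nxa] /= := eqVneq x a.
  case: (eqVneq b (D a)) => [e|nb].
    by rewrite -e tperm1 !perm1 e tpermR.
  rewrite (tpermD (z := a)) //; last by rewrite eq_sym.
  by rewrite tpermR tpermR.
have [->|nxb] /= := eqVneq x b.
  by rewrite tpermL DK (tpermD (z := a)) ?tpermL // eq_sym.
rewrite !swap.
case: (eqVneq x (D a)) nxb => [->|nxDa] nxb.
  rewrite tpermR (tpermD (z := D b)); first last.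
  - by rewrite (inj_eq perm_inj).
  - by rewrite eq_sym.
  by rewrite tpermD // 1?eq_sym // swap eq_sym.
rewrite (tpermD (z := x)) 1?eq_sym //.
case: (eqVneq x (D b)) nxa => [->|nxDb] nxa.
  rewrite DK tpermL tpermD // 1?eq_sym //.
  by rewrite swap eq_sym.
rewrite (tpermD (z := D x)); first last.
- by rewrite (inj_eq perm_inj) eq_sym.
- by rewrite eq_sym swap.
by rewrite tpermD // eq_sym swap.
Qed.

Lemma matching_rem A p a b : matching A p -> a \in A -> p a = b ->
  matching (A :\ a :\ b) (tperm a b * p).
Proof.
move=> mp aA pa; have pK := matchingK mp; have pb : p b = a by rewrite -pa pK.
have nab : a != b by rewrite eq_sym -pa (matching_neq _ mp).
have E x : (tperm a b * p)%g x = if (x == a) || (x == b) then x else p x.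
  rewrite permM; case: tpermP => [->|->|/eqP/negbTE-> /eqP/negbTE->] //.
    by rewrite eqxx.
  by rewrite eqxx orbT.
apply/matchingP; split=> x; rewrite !E ?inE.
  have [->//|/norP[nxa nxb]] := boolP ((x == a) || (x == b)).
  suff -> : (p x == a) || (p x == b) = false by rewrite pK.
  by rewrite -{1}pb -{2}pa !(inj_eq perm_inj) (negbTE nxa) (negbTE nxb).
case: ifP => [/orP[]->|/norP[-> ->]]; rewrite ?eqxx ?andbF //=.
exact: matching_neq.
Qed.

Lemma matching_add A p a b : matching (A :\ a :\ b) p -> a \in A -> b \in A ->
  a != b -> matching A (tperm a b * p) /\ (tperm a b * p)%g a = b.
Proof.
move=> mp aA bA nab; have pK := matchingK mp.
have pa : p a = a by apply: (matching_out mp); rewrite !inE eqxx andbF.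
have pb : p b = b by apply: (matching_out mp); rewrite !inE eqxx.
split; last by rewrite permM tpermL.
apply/matchingP; split=> x; rewrite !permM; case: (tpermP a b x) => [->|->|nxa nxb].
- by rewrite pb tpermR.
- by rewrite pa tpermL.
- rewrite tpermD //; apply/eqP=> e; [case: nxa|case: nxb]; apply: (@perm_inj _ p).
    by rewrite -e pa.
  by rewrite -e pb.
- by rewrite pb eq_sym nab aA.
- by rewrite pa nab bA.
by move/eqP: nxa => nxa; move/eqP: nxb => nxb; rewrite (matching_neq _ mp) !inE nxa nxb.
Qed.

Lemma matching_swap A p a b : matching A p -> a \in A -> b \in A ->
  matching A (tperm a b * p * tperm a b).
Proof.
move=> mp aA bA; have tA x : (tperm a b x \in A) = (x \in A).
  by case: tpermP => [->|->|]; rewrite ?aA ?bA.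
apply/matchingP; split=> x; rewrite !permM ?tpermK ?(matchingK mp) ?tpermK //.
by rewrite -{2}[x](tpermK a b) (inj_eq perm_inj) (matching_neq _ mp) tA.
Qed.

Lemma matching_cut A D a b : matching A D -> a \in A -> b \in A -> a != b ->
  matching (A :\ a :\ b) (cut a b D).
Proof.
move=> mD aA bA nab; have DK := matchingK mD.
have DaA : D a \in A by rewrite (matching_mem _ mD).
have mD' := matching_swap mD bA DaA.
have D'a : (tperm b (D a) * D * tperm b (D a))%g a = b.
  rewrite !permM; case: (eqVneq b (D a)) => [e|ne].
    by rewrite -e tperm1 !perm1.
  rewrite (@tpermD _ _ _ a) ?tpermR 1?eq_sym //.
  by rewrite eq_sym (matching_neq _ mD).
have -> : cut a b D = (tperm a b * (tperm b (D a) * D * tperm b (D a)))%g.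
  rewrite /cut; set u := (_ * _ * tperm b (D a))%g in mD' D'a *.
  have ub : u b = a by rewrite -D'a (matchingK mD').
  by rewrite [RHS]conjgC tpermJ D'a ub tpermC.
exact: matching_rem.
Qed.

(** [tperm x (s x) * s] fixes [s x] and is the cycle of [s] shortened by that
    point elsewhere. *)
Lemma porbits_split s x : s x != x -> #|porbits (tperm x (s x) * s)| = #|porbits s|.+1.
Proof.
move=> nx; have /= := porbits_mul_tperm s x (s x).
rewrite porbit_sym.
have -> : s x \in porbit s x by rewrite -{1}[s]expg1 mem_porbit.
rewrite addn0 => ->.
by rewrite eq_sym nx addn1.
Qed.

(** For [D a != b], the product of the two new pairings is obtained from
    [D * p] by turning [a] and [b] into fixed points of their cycles, since
    [D * p] maps [D a] to [b] and [D b] to [a].  For [D a = b] both points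
    were fixed already and the product does not change. *)
Lemma porbits_cut A D p a b : matching A D -> matching A p -> a \in A -> p a = b ->
  #|porbits (cut a b D * (tperm a b * p))| = (#|porbits (D * p)| + (D a != b).*2)%N.
Proof.
move=> mD mp aA pa.
have -> : (cut a b D * (tperm a b * p))%g =
   (tperm b (D a) * D * tperm b (D a) * p)%g.
  by rewrite /cut -(mulgA _ (tperm a b)) (mulgA (tperm a b)) tperm2 mul1g.
have [Da|nDa] := eqVneq (D a) b.
  by rewrite Da tperm1 mul1g mulg1 addn0.
have DK := matchingK mD; have pK := matchingK mp.
have pb : p b = a by rewrite -pa pK.
have -> : (tperm b (D a) * D * tperm b (D a) * p)%g =
    (tperm (D a) b * (tperm (D b) a * (D * p)))%g.
  have -> : (tperm (D b) a = tperm b (D a) ^ D^-1)%g.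
    by rewrite tpermJ permK; congr tperm; rewrite -{2}(DK b) permK.
  by rewrite (tpermC b) /conjg invgK !mulgA mulgKV.
have nDb : D b != a.
  by rewrite -(inj_eq (@perm_inj _ D)) DK eq_sym.
set s := (D * p)%g.
have sDb : s (D b) = a by rewrite permM DK.
have sDa : (tperm (D b) a * s)%g (D a) = b.
  rewrite permM tpermD ?permM ?DK ?pa //.
    by rewrite (inj_eq perm_inj) -pa (matching_neq _ mp).
  by rewrite eq_sym (matching_neq _ mD).
rewrite -{1}sDa porbits_split ?sDa 1?eq_sym //.
rewrite -{1}sDb porbits_split ?sDb 1?eq_sym //.
by rewrite addn2.
Qed.

Lemma card_fixpoints_porbits A s :
  {in ~: A, forall x, s x = x} -> (#|~: A| <= #|porbits s|)%N.
Proof.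
move=> fixs; rewrite -(card_in_imset (f := porbit s)).
  by apply/subset_leq_card/subsetP => _ /imsetP[x _ ->]; apply: imset_f.
move=> x y xA _ e; have : y \in porbit s x by rewrite e porbit_id.
case/porbitP=> i ->; elim: i => [|i {1}->]; first by rewrite perm1.
by rewrite expgS permM fixs.
Qed.

(** The number of components of the graph with edges [D] and [p] on [A]: each
    of them is the union of two cycles of [D * p], while the points outside [A]
    are fixed points of [D * p]. *)
Definition loops A D p : nat := ((#|porbits (D * p)| - #|~: A|)./2)%N.

(** Contracting the chord [{a, b}] of [p] keeps the loops of [D] and [p],
    except that the loop made of this chord and an edge [{a, b}] of [D]
    disappears. *)
Lemma loops_cut A D p a b : matching A D -> matching A p -> a \in A -> p a = b ->
  loops A D p = ((D a == b) + loops (A :\ a :\ b) (cut a b D) (tperm a b * p))%N.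
Proof.
move=> mD mp aA pa; have nab : a != b by rewrite eq_sym -pa (matching_neq _ mp).
have bA : b \in A by rewrite -pa (matching_mem _ mp).
have cA' : (#|~: (A :\ a :\ b)| = #|~: A| + 2)%N.
  have := cardsC A; rewrite -(cardsC (A :\ a :\ b)) (cardsD1 a A) (cardsD1 b (A :\ a)).
  by rewrite !inE aA bA eq_sym nab /=; lia.
rewrite /loops (porbits_cut mD mp aA pa) cA'.
have [Da|nDa] /= := eqVneq (D a) b; last by rewrite subnDr.
rewrite addn0.
have /card_fixpoints_porbits :
    {in ~: (A :\ a :\ b), forall x, (cut a b D * (tperm a b * p))%g x = x}.
  move=> x; rewrite inE => xA; rewrite permM.
  by rewrite !(matching_out (matching_cut mD _ _ _)) // (matching_out (matching_rem mp _ _)).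
rewrite (porbits_cut mD mp aA pa) Da eqxx addn0 cA' => le.
by rewrite addn2 in le *; rewrite -[X in X./2 = _](subnSK (ltnW le)) -(subnSK le).
Qed.

End Cut.

Section GenFun.
Variables (S : comNzRingType) (u v : S) (T : finType).
Implicit Types (A : {set T}) (p D Q s : {perm T}) (a b x y : T).

Definition loopgf A D Q : S :=
  \sum_(p : {perm T} | matching A p) u ^+ loops A D p * v ^+ loops A Q p.

Lemma loopgf_set0 D Q : matching set0 D -> matching set0 Q -> loopgf set0 D Q = 1.
Proof.
have m1 p : matching set0 p = (p == 1%g).
  apply/idP/eqP => [mp|->].
    by apply/permP => x; rewrite perm1 (matching_out mp) ?inE.
  by apply/matchingP; split=> x; rewrite !perm1 ?inE ?eqxx.
have l0 : @loops T set0 1%g 1%g = 0%N.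
  rewrite /loops setC0 cardsT (_ : (_ - _ = 0)%N) //.
  by apply/eqP; rewrite subn_eq0 leq_imset_card.
rewrite !m1 => /eqP-> /eqP->; rewrite /loopgf (eq_bigl _ _ m1) big_pred1_eq.
by rewrite l0 !expr0 mulr1.
Qed.

(** The pairings [p] with [p a = b] correspond, by multiplication with
    [tperm a b], to the pairings of the remaining points. *)
Lemma loopgf_cut A D Q a : matching A D -> matching A Q -> a \in A ->
  loopgf A D Q = \sum_(b in A :\ a)
    u ^+ (D a == b) * v ^+ (Q a == b) *
    loopgf (A :\ a :\ b) (cut a b D) (cut a b Q).
Proof.
move=> mD mQ aA; rewrite /loopgf.
rewrite (partition_big (fun p : {perm T} => p a) (mem (A :\ a))) /=; last first.
  by move=> p mp; rewrite !inE (matching_neq _ mp) (matching_mem _ mp) aA.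
apply: eq_bigr => b; rewrite !inE => /andP[nba bA].
rewrite big_distrr /= [RHS](reindex_inj (mulgI (tperm a b))) /=.
apply: eq_big => [p|p /andP[mp /eqP pa]].
  apply/andP/idP => [[mp /eqP pa]|mp]; first exact: matching_rem.
  have [|] := matching_add mp aA bA; first by rewrite eq_sym.
  by rewrite mulgA tperm2 mul1g => -> ->.
by rewrite (loops_cut mD mp aA pa) (loops_cut mQ mp aA pa) !exprD mulrACA.
Qed.

End GenFun.

(** * Pairs of pairings as families of alternating cycles *)

Section Alt.
Variable T : eqType.
Implicit Types (f g : T -> T) (x y z : T) (s t : seq T).

Fixpoint altpath f g x s : bool :=
  if s is y :: s' then (f x == y) && altpath g f y s' else true.

Definition altcycle f g s : bool :=
  if s is x :: s' then odd (size s') && altpath f g x (rcons s' x) else true.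

Lemma altpath_cat f g x s t :
  altpath f g x (s ++ t) = altpath f g x s &&
    (if odd (size s) then altpath g f (last x s) t
     else altpath f g (last x s) t).
Proof.
elim: s f g x => [|y s IHs] f g x //=.
by rewrite IHs andbA; case: (odd _).
Qed.

Lemma altpath_rcons f g x s y :
  altpath f g x (rcons s y) = altpath f g x s &&
    ((if odd (size s) then g (last x s) else f (last x s)) == y).
Proof. by rewrite -cats1 altpath_cat /= !andbT; case: (odd _). Qed.

Lemma altpath_rev f g x s : involutive f -> involutive g -> altpath f g x s ->
  if odd (size s) then altpath f g (last x s) (rev (belast x s))
  else altpath g f (last x s) (rev (belast x s)).
Proof.
elim: s f g x => [|y s IHs] f g x fK gK //= /andP[/eqP fxy ps].
have {IHs ps} := IHs _ _ _ gK fK ps; rewrite rev_cons !altpath_rcons size_rev size_belast.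
have -> : last (last y s) (rev (belast y s)) = y by case: s => //= z s; rewrite rev_cons last_rcons.
by case: (odd _) => /= ->; rewrite -fxy fK eqxx.
Qed.

Lemma eq_in_altpath f g f' g' x s :
  (forall y, y \in x :: s -> f y \in x :: s -> f' y = f y) ->
  (forall y, y \in x :: s -> g y \in x :: s -> g' y = g y) ->
  altpath f g x s -> altpath f' g' x s.
Proof.
elim: s f g f' g' x => [|y s IHs] f g f' g' x //= ff' gg' /andP[/eqP fxy ps].
rewrite ff' ?fxy ?eqxx ?inE ?eqxx ?orbT //=.
apply: IHs ps => z zs hz; [apply: gg'|apply: ff']; by rewrite inE ?zs ?hz orbT.
Qed.

Lemma altcycle_rot1 f g s : altcycle f g s -> altcycle g f (rot 1 s).
Proof.
case: s => [|x [|y s]] //; rewrite /rot /= ?drop0 /= => /andP[os].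
case/andP=> fx ps; rewrite cats1 size_rcons /= os /= altpath_rcons.
move: ps os; rewrite !altpath_rcons size_rcons last_rcons /= => /andP[-> ->] /= ->.
by rewrite fx.
Qed.

Lemma altcycle_rev f g x s : involutive f -> involutive g ->
  altcycle f g (x :: s) -> altcycle g f (x :: rev s).
Proof.
move=> fK gK /= /andP[os ps]; rewrite size_rev os /=.
have := altpath_rev fK gK ps.
by rewrite size_rcons /= os belast_rcons last_rcons rev_cons.
Qed.

(** A point at even distance from the head becomes the head by rotation; for
    one at odd distance the rotated cycle begins with [g] and must in addition be
    run backwards. *)
Lemma altcycle_at f g s b : involutive f -> involutive g ->
  altcycle f g s -> b \in s ->
  exists2 m, perm_eq s (b :: m) & altcycle f g (b :: m).
Proof.
move=> fK gK cs bs; set i := index b s.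
have : exists m, rot i s = b :: m.
  by exists (drop i.+1 s ++ take i s); rewrite /rot (drop_nth b) ?index_mem // nth_index.
case=> m rs.
have ps : perm_eq s (b :: m) by rewrite -rs perm_sym perm_rot.
have : altcycle f g (rot i s) || altcycle g f (rot i s).
  rewrite {rs ps}; have : (i <= size s)%N by rewrite index_size.
  elim: i => [|i IHi] lei; first by rewrite rot0 cs.
  have -> : rot i.+1 s = rot 1 (rot i s) by rewrite rotS.
  by case/orP: (IHi (ltnW lei)) => /altcycle_rot1 ->; rewrite ?orbT.
rewrite rs => /orP[c|c]; first by exists m.
exists (rev m); last exact: altcycle_rev.
by rewrite (perm_trans ps) // perm_cons perm_sym perm_rev.
Qed.

End Alt.

Section System.
Variable T : finType.
Implicit Types (A : {set T}) (D Q : {perm T}) (a b x y : T) (s t : seq T).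
Implicit Type Ls : seq (seq T).

(** The pairings [D] and [Q] of [A] together form the polygons listed in [Ls],
    each beginning with an edge of [D].  Empty polygons are admitted, because
    splitting off an edge of [D] or [Q] leaves one. *)
Definition system A D Q Ls : Prop :=
  [/\ matching A D, matching A Q, uniq (flatten Ls), A =i flatten Ls
    & all (altcycle D Q) Ls].

Section CutFacts.
Variables (A : {set T}) (a b : T).
Hypotheses (aA : a \in A) (bA : b \in A) (nab : a != b).

Lemma cut_id D x : matching A D -> x != a -> x != b -> D x != a -> D x != b ->
  cut a b D x = D x.
Proof.
move=> mD /negbTE xa /negbTE xb /negbTE Dxa /negbTE Dxb.
by rewrite (cutE _ mD aA bA nab) xa xb Dxa Dxb.
Qed.

Lemma cut_l D x : matching A D -> D a = x -> x != b -> cut a b D x = D b.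
Proof.
move=> mD Da /negbTE xb; have := matchingK mD a; rewrite Da => Dx.
by rewrite (cutE _ mD aA bA nab) xb Dx eqxx -Da (negbTE (_ : D a != a)) // (matching_neq _ mD).
Qed.

Lemma cut_r D x : matching A D -> D b = x -> x != a -> cut a b D x = D a.
Proof.
move=> mD Db /negbTE xa; have := matchingK mD b; rewrite Db => Dx.
rewrite (cutE _ mD aA bA nab) xa Dx eqxx [b == a]eq_sym (negbTE nab).
by rewrite -Db (negbTE (_ : D b != b)) // (matching_neq _ mD).
Qed.

Lemma altpath_cut D Q x s : matching A D -> matching A Q ->
  a \notin x :: s -> b \notin x :: s ->
  altpath D Q x s -> altpath (cut a b D) (cut a b Q) x s.
Proof.
move=> mD mQ as_ bs; apply: eq_in_altpath => y ys gys; apply: cut_id => //.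
all: by [apply: contraNneq as_ => <-|apply: contraNneq bs => <-].
Qed.

Lemma altcycle_cut D Q s : matching A D -> matching A Q ->
  a \notin s -> b \notin s ->
  altcycle D Q s -> altcycle (cut a b D) (cut a b Q) s.
Proof.
case: s => //= x s mD mQ as_ bs /andP[-> ps]; apply: altpath_cut => //.
  by move: as_; rewrite !inE mem_rcons inE orbA orbb.
by move: bs; rewrite !inE mem_rcons inE orbA orbb.
Qed.

Lemma all_altcycle_cut D Q Ls : matching A D -> matching A Q ->
  a \notin flatten Ls -> b \notin flatten Ls ->
  all (altcycle D Q) Ls -> all (altcycle (cut a b D) (cut a b Q)) Ls.
Proof.
move=> mD mQ aL bL /allP cL; apply/allP => s sL; apply: altcycle_cut (cL s sL) => //.
  by apply: contra aL => as_; apply/flattenP; exists s.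
by apply: contra bL => bs; apply/flattenP; exists s.
Qed.

End CutFacts.

Lemma system_cut A D Q Ls Ls' a b : system A D Q Ls ->
  perm_eq (flatten Ls) (a :: b :: flatten Ls') ->
  all (altcycle (cut a b D) (cut a b Q)) Ls' ->
  system (A :\ a :\ b) (cut a b D) (cut a b Q) Ls'.
Proof.
case=> mD mQ uL AL cL pL cL'; have := uL; rewrite (perm_uniq pL) /= inE negb_or.
case/and3P=> /andP[nab aL] bL uL'.
have aA : a \in A by rewrite AL (perm_mem pL) inE eqxx.
have bA : b \in A by rewrite AL (perm_mem pL) !inE eqxx orbT.
split=> //; try exact: matching_cut.
move=> x; rewrite !inE AL (perm_mem pL) !inE.
have [->|_] /= := eqVneq x b; first by rewrite (negbTE bL).
by have [->|_] /= := eqVneq x a; first by rewrite (negbTE aL).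
Qed.

(** At odd distance the edges at [a] and [b] that lead into [s] are both in
    [D], and those that lead into [t] both in [Q].  So [s] and [t] are closed up
    separately, and a part is empty exactly when [a] and [b] are joined by an
    edge. *)
Lemma system_split A D Q a b s t Ls : ~~ odd (size s) ->
  system A D Q ((a :: s ++ b :: t) :: Ls) ->
  [/\ system (A :\ a :\ b) (cut a b D) (cut a b Q) [:: rot 1 s, t & Ls],
      (D a == b) = nilp s & (Q a == b) = nilp t].
Proof.
move=> os sL; have [mD mQ uL AL /= /andP[/andP[oL pL] cL]] := sL.
have pfl : perm_eq (flatten ((a :: s ++ b :: t) :: Ls))
      (a :: b :: s ++ t ++ flatten Ls).
  by rewrite /= perm_cons -catA -(cat1s b t) -catA perm_catCA /= perm_cons.
have := uL; rewrite (perm_uniq pfl) /= inE !mem_cat !negb_or.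
case/and3P=> /and4P[nab as_ at_ aL] /and3P[bs bt bL] _.
have aA : a \in A by rewrite AL (perm_mem pfl) inE eqxx.
have bA : b \in A by rewrite AL (perm_mem pfl) !inE eqxx orbT.
have ot : ~~ odd (size t).
  by move: oL; rewrite size_cat oddD (negbTE os).
move: pL; rewrite rcons_cat altpath_cat (negbTE os) /=.
case/and3P=> ps /eqP Db; rewrite altpath_rcons (negbTE ot) => /andP[pt /eqP Qa].
have DK := matchingK mD; have QK := matchingK mQ.
have Da : D a = head b s.
  by case: (s) ps Db => [|x s'] //= /andP[/eqP].
have Qb : Q b = head a t.
  by case: (t) pt Qa => [|x t'] //= /andP[/eqP].
split.
- have pfl' : perm_eq (flatten ((a :: s ++ b :: t) :: Ls))
      (a :: b :: flatten [:: rot 1 s, t & Ls]).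
    apply: perm_trans pfl _; rewrite !perm_cons.
    have -> : flatten [:: rot 1 s, t & Ls] = rot 1 s ++ t ++ flatten Ls by [].
    by rewrite perm_cat2r perm_sym perm_rot.
  apply: system_cut sL pfl' _; rewrite /= altcycle_rot1 /=.
    apply/andP; split; last exact: (all_altcycle_cut aA bA nab).

    case: (t) ot Qb pt Qa at_ bt => //= y t' /negPn ot Qb /andP[_ pt] Qa at_ bt.
    rewrite ot altpath_rcons ot (altpath_cut aA bA nab) //=.
    rewrite (cut_l aA bA nab mQ) ?Qb //; first by rewrite -Qa QK.
    by apply: contraNneq bt => <-; rewrite mem_last.
  case: (s) os ps as_ bs Da Db => //= x s' /negPn os /andP[_ ps] as_ bs Da Db.
  rewrite os altpath_rcons os (altpath_cut aA bA nab) //=.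
  rewrite (cut_r aA bA nab mD) ?Da //; first by rewrite -Db DK.
  by apply: contraNneq as_ => <-; rewrite mem_last.
- rewrite Da; case: (s) bs => [|x s'] /=; first by rewrite eqxx.
  by rewrite inE negb_or => /andP[/negbTE]; rewrite eq_sym.
- rewrite -(inj_eq (@perm_inj _ Q)) QK Qb; case: (t) at_ => [|x t'] /=; first by rewrite eqxx.
  by rewrite inE negb_or => /andP[/negbTE]; rewrite eq_sym.
Qed.

(** When [D] maps [a] and [b] to the heads of [s] and [t], and [Q] maps
    them to the last points, in whichever order, the cut joins the heads by [D]
    and the last points by [Q].  This covers both a chord at even distance in
    one polygon [a :: s ++ b :: t] and a chord between the polygons [a :: s] and
    [b :: t]. *)
Lemma altcycle_merge A D Q a b s t : a \in A -> b \in A -> uniq (a :: b :: s ++ t) ->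
  matching A D -> matching A Q -> odd (size s) -> odd (size t) ->
  altpath D Q a s -> altpath D Q b t ->
  (Q (last a s) == a) && (Q (last b t) == b) ||
  (Q (last a s) == b) && (Q (last b t) == a) ->
  altcycle (cut a b D) (cut a b Q) (rev s ++ t).
Proof.
move=> aA bA uab mD mQ os ot ps pt Qst.
have DK := matchingK mD; have QK := matchingK mQ.
move: uab; rewrite /= inE !mem_cat !negb_or => /and3P[/and3P[nab as_ at_] /andP[bs bt] _].
case: s os ps as_ bs Qst => //= x s os /andP[/eqP Da ps] as_ bs.
case: t ot pt at_ bt => //= y t ot /andP[/eqP Db pt] at_ bt Qst.
have D'K := matchingK (matching_cut mD aA bA nab).
have Q'K := matchingK (matching_cut mQ aA bA nab).
have := altpath_rev Q'K D'K (altpath_cut aA bA nab mQ mD as_ bs ps).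
rewrite (negbTE os) => rs.
have lx : last (last x s) (rev (belast x s)) = x.
  by case: (s) => //= z s'; rewrite rev_cons last_rcons.
rewrite lastI rev_rcons /= rcons_cat altpath_cat size_rev size_belast (negbTE os).
rewrite rs lx /= altpath_rcons (negbTE ot) (altpath_cut aA bA nab mQ mD at_ bt pt).
rewrite size_cat size_rev size_belast.
rewrite /= addnS /= oddD (negbTE os) (negbTE ot) /=.
have nxb : x != b by apply: contraNneq bs => <-; rewrite mem_head.
have lya : last y t != a by apply: contraNneq at_ => <-; rewrite mem_last.
have lyb : last y t != b by apply: contraNneq bt => <-; rewrite mem_last.
rewrite (cut_l aA bA nab mD Da nxb) Db eqxx /=.
have Qs u v : Q u = v -> Q v = u by move=> <-; rewrite QK.
case/orP: Qst => /andP[/eqP/Qs Qz /eqP/Qs Qw].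
  by rewrite (cut_r aA bA nab mQ Qw lya) Qz.
by rewrite (cut_l aA bA nab mQ Qw lyb) Qz.
Qed.

Lemma system_twist A D Q a b s t Ls : odd (size s) ->
  system A D Q ((a :: s ++ b :: t) :: Ls) ->
  [/\ system (A :\ a :\ b) (cut a b D) (cut a b Q) ((rev s ++ t) :: Ls),
      D a != b & Q a != b].
Proof.
move=> os sL; have [mD mQ uL AL /= /andP[/andP[oL pL] cL]] := sL.
have pfl : perm_eq (flatten ((a :: s ++ b :: t) :: Ls))
      (a :: b :: (s ++ t) ++ flatten Ls).
  by rewrite /= perm_cons -!catA -(cat1s b t) -catA perm_catCA /= perm_cons.
have := uL; rewrite (perm_uniq pfl) => uL'.
have := uL'; rewrite /= inE !mem_cat !negb_or.
case/and3P=> /andP[nab /andP[/andP[as_ at_] aL]] /andP[/andP[bs bt] bL] _.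
have aA : a \in A by rewrite AL (perm_mem pfl) inE eqxx.
have bA : b \in A by rewrite AL (perm_mem pfl) !inE eqxx orbT.
have ot : odd (size t).
  by move: oL; rewrite size_cat oddD os /= negbK.
move: pL; rewrite rcons_cat altpath_cat os /=.
case/and3P=> ps /eqP Qs; rewrite altpath_rcons ot => /andP[pt /eqP Qt].
have pfl' : perm_eq (flatten ((a :: s ++ b :: t) :: Ls))
    (a :: b :: flatten ((rev s ++ t) :: Ls)).
  apply: perm_trans pfl _; rewrite !perm_cons /= perm_cat2r perm_cat2r.
  by rewrite perm_sym perm_rev.
split.
- apply: system_cut sL pfl' _; apply/andP; split.
    apply: (altcycle_merge aA bA) => //; last by rewrite Qs Qt !eqxx orbT.
    by move: uL'; rewrite -!cat_cons cat_uniq => /and3P[].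
  exact: (all_altcycle_cut aA bA nab).
- case: (s) os ps bs => //= x s' _ /andP[/eqP-> _].
  by apply: contraNneq => <-; rewrite mem_head.
rewrite -(inj_eq (@perm_inj _ Q)) (matchingK mQ) -Qs (matchingK mQ).
case: (s) os as_ => //= x s' _; apply: contraNneq => ->.
exact: mem_last.
Qed.

(** Here [M] is the polygon through [b], and [t] lists its other points in the
    direction in which they are reached from [b] by an edge of [D]. *)
Lemma system_merge A D Q a b s Ls : b \in flatten Ls ->
  system A D Q ((a :: s) :: Ls) ->
  [/\ D a != b, Q a != b & exists M t Ls',
      [/\ perm_eq Ls (M :: Ls'), size M = (size t).+1, odd (size s), odd (size t)
      & system (A :\ a :\ b) (cut a b D) (cut a b Q) ((rev s ++ t) :: Ls')]].
Proof.
move=> bLs sL; have [mD mQ uL AL /= /andP[/andP[os ps] cL]] := sL.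
have /flattenP[M MLs bM] := bLs.
have [t pM /= /andP[ot pt]] := altcycle_at (matchingK mD) (matchingK mQ) (allP cL M MLs) bM.
have pLs : perm_eq Ls (M :: rem M Ls) := perm_to_rem MLs.
set Ls' := rem M Ls in pLs.
have cL' : all (altcycle D Q) Ls'.
  by move: cL; rewrite (perm_all _ pLs) /= => /andP[].
have pfl : perm_eq (flatten ((a :: s) :: Ls)) (a :: b :: (s ++ t) ++ flatten Ls').
  rewrite /= perm_cons; apply: (@perm_trans _ (s ++ (b :: t) ++ flatten Ls')).
    rewrite perm_cat2l (perm_trans (perm_flatten pLs)) //=.
    by rewrite -cat_cons perm_cat2r.
  by rewrite -catA -(cat1s b t) -catA perm_catCA.
have := uL; rewrite (perm_uniq pfl) => uL'.
have := uL'; rewrite /= inE !mem_cat !negb_or.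
case/and3P=> /andP[nab /andP[/andP[as_ at_] aL]] /andP[/andP[bs bt] bL] _.
have aA : a \in A by rewrite AL (perm_mem pfl) inE eqxx.
have bA : b \in A by rewrite AL (perm_mem pfl) !inE eqxx orbT.
have pfl' : perm_eq (flatten ((a :: s) :: Ls))
    (a :: b :: flatten ((rev s ++ t) :: Ls')).
  apply: perm_trans pfl _; rewrite !perm_cons /= perm_cat2r perm_cat2r.
  by rewrite perm_sym perm_rev.
move: ps pt; rewrite !altpath_rcons os ot => /andP[ps /eqP Qs] /andP[pt /eqP Qt].
split.
- case: (s) os ps bs => //= x s' _ /andP[/eqP-> _].
  by apply: contraNneq => <-; rewrite mem_head.
- rewrite -(inj_eq (@perm_inj _ Q)) (matchingK mQ) -Qt (matchingK mQ).
  case: (t) ot at_ => //= x t' _; apply: contraNneq => ->.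
  exact: mem_last.
exists M, t, Ls'; split=> //; first by rewrite (perm_size pM).
apply: system_cut sL pfl' _; apply/andP; split.
  apply: (altcycle_merge aA bA) => //; last by rewrite Qs Qt !eqxx.
  by move: uL'; rewrite -!cat_cons cat_uniq => /and3P[].
exact: (all_altcycle_cut aA bA nab).
Qed.

End System.

(** * The two leading coefficients of the loop polynomial *)

Section Top.
Variable R : comNzRingType.
Implicit Types (G H : {poly R}) (d e : nat).

(** [G] has degree at most [d], and its coefficients of degree [d] and [d - 1]
    are the coefficients of degree 0 and 1 of [H]; thus [H] matters modulo
    ['X^2] only.  The factor ['X] in the equation makes room for the coefficient of
    degree [d - 1] when [d = 0], which then has to be zero. *)
Definition topcoef d G H : Prop :=
  forall e, (d <= e)%N -> (G * 'X)`_e = if (e <= d.+1)%N then H`_(d.+1 - e) else 0.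

Lemma topcoefD d G1 G2 H1 H2 :
  topcoef d G1 H1 -> topcoef d G2 H2 -> topcoef d (G1 + G2) (H1 + H2).
Proof.
move=> h1 h2 e le; rewrite mulrDl !coefD h1 // h2 //.
by case: ifP => _; rewrite ?coefD ?addr0.
Qed.

Lemma topcoef0 d : topcoef d 0 0.
Proof. by move=> e _; rewrite mul0r !coef0 if_same. Qed.

Lemma topcoefC d a G H : topcoef d G H -> topcoef d (a%:P * G) (a%:P * H).
Proof.
move=> h e le; rewrite -mulrA !coefCM h //.
by case: ifP => _; rewrite ?mulr0.
Qed.

Lemma topcoefX d G H : topcoef d G H -> topcoef d.+1 ('X * G) H.
Proof.
move=> h [|e] //; rewrite ltnS => le; rewrite -mulrA coefXM /= h //.
Qed.

Lemma topcoefXb d (b : bool) G H : topcoef d G H -> topcoef (b + d) ('X ^+ b * G) H.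
Proof. by case: b => [/topcoefX//|]; rewrite expr0 mul1r. Qed.

Lemma topcoef_shift d G H : topcoef d G H -> topcoef d.+1 G ('X * H).
Proof.
move=> h e le; rewrite h ?(ltnW le) // coefXM.
have [e1|e1|->] := ltngtP e d.+1.
- by move: e1; rewrite ltnS leqNgt le.
- rewrite leq_eqVlt; case: eqVneq => [->|_]; first by rewrite subnn.
  by case: ifP => // e2; have := leq_trans e2 e1; rewrite ltnn.
- by rewrite leqnSn subSnn subnn.
Qed.

Lemma topcoef_low d G H : topcoef d G H -> topcoef d.+2 G 0.
Proof.
move=> h e le; rewrite h ?(ltnW (ltnW le)) // coef0 if_same.
by rewrite leqNgt le.
Qed.

Lemma topcoef_sum d (I : Type) (r : seq I) (F K : I -> {poly R}) (P : pred I) :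
  (forall i, P i -> topcoef d (F i) (K i)) ->
  topcoef d (\sum_(i <- r | P i) F i) (\sum_(i <- r | P i) K i).
Proof.
move=> h; apply: (big_ind2 (topcoef d)) => //; first exact: topcoef0.
by move=> *; apply: topcoefD.
Qed.

Lemma topcoef_coef d G H : topcoef d.+1 G H -> G`_d = H`_1.
Proof. by move=> /(_ d.+1 (leqnn _)); rewrite coefMX /= leqnSn subSnn. Qed.

End Top.

Section Moments.
Variables (R : comNzRingType) (c : R).

(** Modulo ['X^2], [M n] carries the planar moment in degree 0 and the
    projective one in degree 1. *)
Definition is_moments (M : nat -> {poly R}) : Prop :=
  M 0%N = 1 /\ forall n, M n.+1 =
    n%:R * ('X * M n) + \sum_(k < n.+1) c%:P ^+ (k == 0%N :> nat) * M k * M (n - k)%N.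

Fixpoint moment_tab n : seq {poly R} :=
  if n is n'.+1 then
    let t := moment_tab n' in
    rcons t (n'%:R * ('X * t`_n') + \sum_(k < n'.+1) c%:P ^+ (k == 0%N :> nat) * t`_k * t`_(n' - k))
  else [:: 1].

Lemma exists_moments : exists M, is_moments M.
Proof.
have size_tab n : size (moment_tab n) = n.+1.
  by elim: n => //= n IHn; rewrite size_rcons IHn.
exists (fun n => (moment_tab n)`_n); split=> // n.
have tab k j : (j <= k)%N -> (moment_tab k)`_j = (moment_tab j)`_j.
  elim: k => [|k IHk]; first by case: j.
  rewrite leq_eqVlt => /orP[/eqP->//|]; rewrite ltnS => le.
  by rewrite /= nth_rcons size_tab ltnS le IHk.
rewrite /= nth_rcons size_tab ltnn eqxx; congr (_ + _).
by apply: eq_bigr => k _; rewrite !(tab n) ?leq_subr // -ltnS.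
Qed.

Lemma sum_odd_even n (P : {poly R}) (F : nat -> {poly R}) :
  \sum_(i < n.*2.+1) (if odd i then P else F i./2) = n%:R * P + \sum_(k < n.+1) F k.
Proof.
elim: n => [|n IHn]; first by rewrite !big_ord1 mul0r add0r.
rewrite doubleS big_ord_recr big_ord_recr IHn [in RHS]big_ord_recr /=.
rewrite !odd_double /=. by rewrite doubleK -natr1; ring.
Qed.

Variable M : nat -> {poly R}.
Hypothesis momM : is_moments M.

(** The bound for the degree of the loop polynomial: half of the number of
    points plus the number of nonempty polygons. *)
Definition weight (T : Type) (Ls : seq (seq T)) := (\sum_(s <- Ls) ((size s)./2 + ~~ nilp s))%N.

(** Induction along [loopgf_cut] at the head of the first polygon, with [2n + 2]
    sides.  A partner at odd distance [2k + 1] gives the product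
    [M k * M (n - k)] (with a factor [c] if [k = 0], for the loop along [D]), each
    of the [n] partners at even distance gives ['X * M n], and the partners in
    other polygons only contribute two degrees below the leading one. *)
Lemma loopgf_topcoef (T : finType) (A : {set T}) (D Q : {perm T}) Ls :
  system A D Q Ls ->
  topcoef (weight Ls) (loopgf (c%:P * 'X) 'X A D Q) (\prod_(s <- Ls) M (size s)./2).
Proof.
have [m] := ubnP (size (flatten Ls) + size Ls).
elim: m => // m IHm in A D Q Ls * => lem sL.
case: Ls => [|s Ls] in lem sL *.
  have A0 : A = set0 by case: sL => _ _ _ AL _; apply/setP => x; rewrite AL inE.
  case: sL => mD mQ _ _ _; rewrite A0 in mD mQ *.
  rewrite loopgf_set0 // big_nil /weight big_nil => e _.
  by rewrite mul1r coefX coef1; case: e => [|[|e]].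
case: s => [|a s] in lem sL *.
  rewrite /weight !big_cons /= add0n (proj1 momM) mul1r; apply: IHm; last by case: sL.
  by move: lem; rewrite /= addnS.
have [mD mQ uL AL /= /andP[/andP[os ps] cL]] := sL.
have aA : a \in A by rewrite AL /= mem_head.
rewrite (loopgf_cut _ _ mD mQ aA).
pose t b : {poly R} := (c%:P * 'X) ^+ (D a == b) * 'X^(Q a == b) *
  loopgf (c%:P * 'X) 'X (A :\ a :\ b) (cut a b D) (cut a b Q).
rewrite (_ : \sum_(b in A :\ a) _ = \sum_(b <- s) t b + \sum_(b <- flatten Ls) t b);
  last first.
  rewrite -big_cat /= big_uniq /=; last by move: uL => /= /andP[].
  apply: eq_bigl => b; rewrite in_setD1 AL /= in_cons -/(flatten _).
  have [->|//] := eqVneq b a.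
  by move: uL => /= /andP[/negbTE->].
set Pi := \prod_(s <- Ls) M (size s)./2.
set n := (size s)./2; have sn : size s = n.*2.+1 by rewrite /n; lia.
have wL : weight ((a :: s) :: Ls) = (n + weight Ls).+2.
  by rewrite /weight big_cons /=; lia.
rewrite big_cons -/Pi wL.
have cut_other : topcoef (n + weight Ls).+2 (\sum_(b <- flatten Ls) t b) 0.
  rewrite big_seq; apply: (big_ind (fun G => topcoef _ G 0)) => [|G1 G2 h1 h2|b bL].
  - exact: topcoef0.
  - by rewrite -[X in topcoef _ _ X]addr0; apply: topcoefD.
  rewrite /t.
  have [/negbTE-> /negbTE-> [N [r [Ls' [pLs sN _ or sL']]]]] := system_merge bL sL.
  rewrite !expr0 !mul1r.
  have -> : (n + weight Ls)%N = weight ((rev s ++ r) :: Ls').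
    rewrite /weight (perm_big _ pLs) /= !big_cons /nilp size_cat size_rev sN sn; lia.
  apply: topcoef_low; apply: IHm sL'.
  move: lem; rewrite /= !size_cat size_rev (perm_size pLs).
  rewrite (perm_size (perm_flatten pLs)) /= size_cat sN; lia.
rewrite -[_ * Pi]addr0; apply: topcoefD cut_other.
have -> : M (size (a :: s))./2 * Pi = \sum_(i < size s)
    (if odd i then 'X * (M n * Pi)
     else c%:P ^+ (i./2 == 0)%N * (M i./2 * (M (n - i./2)%N * Pi))).
  rewrite sn (sum_odd_even _ _ (fun k => c%:P ^+ (k == 0)%N * (M k * (M (n - k)%N * Pi)))).
  rewrite /= sn /= doubleK (proj2 momM) mulrDl mulr_suml -!mulrA; congr (_ + _).
  by apply: eq_bigr => k _; rewrite !mulrA.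
rewrite (big_nth a) big_mkord; apply: topcoef_sum => -[i lti] _ /=.
(* [i] is the number of points between the head [a] and its partner [b]. *)
set b := nth a s i.
have si : s = take i s ++ b :: drop i.+1 s by rewrite -drop_nth ?cat_take_drop.
have szi : size (take i s) = i by rewrite size_takel // ltnW.
have szd : size (drop i.+1 s) = (n.*2 - i)%N by rewrite size_drop sn subSS.
have li : (i <= n.*2)%N by rewrite -ltnS -sn.
move: sL; rewrite {1}si => sL.
rewrite /t; case: ifP => oi.
  have [|sL' /negbTE-> /negbTE->] := system_twist _ sL; first by rewrite szi.
  rewrite !expr0 !mul1r.
  have -> : (n + weight Ls).+2 = (weight ((rev (take i s) ++ drop i.+1 s) :: Ls)).+1.
    by rewrite /weight big_cons /nilp size_cat size_rev szi szd; lia.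
  apply: topcoef_shift.
  have -> : M n * Pi = \prod_(r <- (rev (take i s) ++ drop i.+1 s) :: Ls) M (size r)./2.
    by rewrite big_cons size_cat size_rev szi szd subnKC // doubleK.
  apply: IHm sL'.
  by move: lem; rewrite /= !size_cat size_rev szi szd sn; lia.
have [|sL' -> ->] := system_split _ sL; first by rewrite szi oi.
have -> : (n + weight Ls).+2 = (nilp (take i s) + (nilp (drop i.+1 s) +
     weight [:: rot 1 (take i s), drop i.+1 s & Ls]))%N.
  rewrite /weight !big_cons /nilp size_rot szi szd; lia.
rewrite exprMn -!mulrA.
have -> : (i./2 == 0)%N = nilp (take i s) by rewrite /nilp szi; lia.
rewrite -!polyC_exp; apply: topcoefC; apply: topcoefXb; apply: topcoefXb.
have -> : M i./2 * (M (n - i./2)%N * Pi) =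
    \prod_(r <- [:: rot 1 (take i s), drop i.+1 s & Ls]) M (size r)./2.
  rewrite !big_cons size_rot szi szd; congr (_ * (M _ * _)); lia.
apply: IHm sL'.
have -> : flatten [:: rot 1 (take i s), drop i.+1 s & Ls]
  = rot 1 (take i s) ++ drop i.+1 s ++ flatten Ls by [].
have : flatten ((a :: s) :: Ls) = (a :: s) ++ flatten Ls by [].
move: lem => /[swap] ->; rewrite (size_cat (rot _ _)) size_rot !size_cat.
rewrite szi szd /=; lia.
Qed.

End Moments.

(** * Annular permutations as projective pairings *)

Lemma porbit_semiconj (T T' : finType) (f : T -> T') (u : {perm T}) (v : {perm T'}) x :
  (forall y, v (f y) = f (u y)) -> porbit v (f x) = f @: porbit u x.
Proof.
move=> fuv; have fuvX i y : (v ^+ i)%g (f y) = f ((u ^+ i)%g y).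
  by elim: i y => [|i IHi] y; rewrite ?perm1 // !expgS !permM fuv IHi.
apply/setP=> y; apply/porbitP/imsetP => [[i ->]|[z /porbitP[i ->] ->]].
  by exists ((u ^+ i)%g x); rewrite ?mem_porbit.
by exists i.
Qed.

Lemma card_porbits_mulC (T : finType) (s t : {perm T}) :
  #|porbits (s * t)| = #|porbits (t * s)|.
Proof.
have h y : (t * s)%g (s y) = s ((s * t)%g y) by rewrite !permM.
rewrite -(card_imset _ (imset_inj (@perm_inj _ s))); congr #|pred_of_set _|.
apply/setP=> B; apply/imsetP/imsetP => [[C /imsetP[x _ ->] ->]|[x _ ->]].
  by exists (s x); rewrite // (porbit_semiconj _ h).
exists (porbit (s * t) ((s^-1)%g x)); first exact: imset_f.
by rewrite -(porbit_semiconj _ h) permKV.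
Qed.

(** Each cycle of [u] lies in one of the two copies of [I]. *)
Lemma card_porbits_bool (I : finType) (u : {perm bool * I}) (v : bool -> {perm I}) :
  (forall b i, u (b, i) = (b, v b i)) ->
  #|porbits u| = (#|porbits (v false)| + #|porbits (v true)|)%N.
Proof.
move=> uv; pose h b (C : {set I}) : {set bool * I} := [set (b, i) | i in C].
have hporb b i : porbit u (b, i) = h b (porbit (v b) i).
  by apply: porbit_semiconj => j; rewrite uv.
have hinj b : injective (h b) by apply: imset_inj => i j [].
have -> : porbits u = h false @: porbits (v false) :|: h true @: porbits (v true).
  apply/setP=> B; rewrite inE; apply/imsetP/orP => [[[b i] _ ->]|].
    by rewrite hporb; case: b; [right|left]; do 2 apply: imset_f.
  by case=> /imsetP[_ /imsetP[i _ ->] ->]; eexists; rewrite -?hporb.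
rewrite cardsU !(card_imset _ (hinj _)) (_ : _ :&: _ = set0) ?cards0 ?subn0 //.
apply/setP=> B; rewrite !inE; apply/andP => -[].
case/imsetP=> _ /imsetP[i _ ->] -> /imsetP[C _ /setP/(_ (false, i))].
have -> : (false, i) \in h false (porbit (v false) i) by rewrite imset_f ?porbit_id.
by move/esym/imsetP=> [].
Qed.

Lemma pairing_matching (T : finType) (p : {perm T}) : pairing p = matching [set: T] p.
Proof.
apply/idP/idP=> [/pairingP pp|mp].
  by apply/matchingP; split=> x; have [] := pp x; rewrite // inE.
apply/forall_inP=> _ /imsetP[x _ ->].
have -> : porbit p x = [set x; p x].
  apply/setP=> y; rewrite !inE; apply/porbitP/orP.
    case=> i ->; elim: i => [|i IHi]; first by rewrite perm1 eqxx; left.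
    rewrite expgSr permM; case: IHi => /eqP->; rewrite ?(matchingK mp) eqxx; by [left|right].
  by case=> /eqP->; [exists 0; rewrite perm1|exists 1; rewrite expg1].
by rewrite cards2 [x == _]eq_sym (matching_neq _ mp) inE.
Qed.

Section Annular.
Variable n' : nat.
Let n := n'.+1.
Implicit Types (p s : {perm pm n}) (i j : 'I_n).

(** The pairing with pairs [{gamma k, -k}]. *)
Definition epsilon : {perm pm n} := (delta n ^ gamma n)%g.

Lemma deltaE b i : delta n (b, i) = (~~ b, i).
Proof. by rewrite permE. Qed.

Lemma gamma_inv b i : ((gamma n)^-1)%g (b, i) = (b, if b then i else ord_pred i).
Proof.
apply: (@perm_inj _ (gamma n)); rewrite permKV permE /gamma_fun /=.
by case: b => //; rewrite ord_predK.
Qed.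

Lemma epsilonE b i : epsilon (b, i) = (~~ b, if b then ordS i else ord_pred i).
Proof.
rewrite /epsilon /conjg !permM gamma_inv deltaE permE /gamma_fun /=.
by case: b.
Qed.

Lemma matching_delta : matching setT (delta n).
Proof.
apply/matchingP; split=> -[b i]; rewrite !deltaE ?negbK // inE.
by apply/eqP=> -[]; case: b.
Qed.

Lemma matching_epsilon : matching setT epsilon.
Proof.
apply/matchingP; split=> -[b i]; rewrite !epsilonE ?negbK ?inE.
  by case: b; rewrite ?ordSK ?ord_predK.
by apply/eqP=> -[]; case: b.
Qed.

Lemma gammatE : gammat n = (delta n * epsilon)%g.
Proof. by rewrite /gammat /rmulp /epsilon /conjg !mulgA. Qed.

Lemma gammat_app b i : gammat n (b, i) = (b, if b then ord_pred i else ordS i).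
Proof. by rewrite gammatE permM deltaE epsilonE negbK; case: b. Qed.

Lemma iter_ordS k : iter k (@ordS n) ord0 = (k %% n)%N :> nat.
Proof.
elim: k => [|k IHk] //=.
by rewrite IHk -addn1 -[in RHS]addn1 modnDml.
Qed.

Lemma ord_iter_ordS i : i = iter i (@ordS n) ord0.
Proof. by apply: val_inj; rewrite /= iter_ordS modn_small. Qed.

Definition rim : seq (pm n) :=
  flatten [seq [:: (false, i); (true, i)] | i <- traject (@ordS n) ord0 n].

Lemma mem_rim x : x \in rim.
Proof.
case: x => b i; apply/flattenP; exists [:: (false, i); (true, i)]; last first.
  by case: b; rewrite !inE eqxx ?orbT.
by apply: map_f; apply/trajectP; exists i => //; apply: ord_iter_ordS.
Qed.

Lemma size_rim : size rim = n.*2.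
Proof.
rewrite /rim size_flatten /shape -map_comp sumnE big_map.
by rewrite (eq_bigr (fun=> 2)) // big_const_seq iter_addn addn0 count_predT size_traject mul2n.
Qed.

Lemma altpath_rim i js k :
  altpath (delta n) epsilon (false, i)
    (rcons ((true, i) :: flatten [seq [:: (false, j); (true, j)] | j <- js]) (false, k))
  = fpath (@ordS n) i (rcons js k).
Proof.
elim: js i => [|j js IHjs] i /=; first by rewrite deltaE eqxx epsilonE /= xpair_eqE /=.
rewrite deltaE eqxx epsilonE /= xpair_eqE /= -IHjs /= deltaE !eqxx /=.
by [].
Qed.

Lemma system_rim : system setT (delta n) epsilon [:: rim].
Proof.
have fr : flatten [:: rim] = rim by exact: cats0.
split; rewrite ?fr ?all_seq1 //; first exact: matching_delta.
- exact: matching_epsilon.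
- apply: (@leq_size_uniq _ (enum {: pm n})); first exact: enum_uniq.
    by move=> x _; apply: mem_rim.
  by rewrite -cardE card_prod card_bool card_ord size_rim mul2n.
- by move=> x; rewrite inE mem_rim.
pose js := traject (@ordS n) (ordS ord0) n'.
pose tl := (true, ord0) :: flatten [seq [:: (false, j); (true, j)] | j <- js].
have rimE : rim = (false, ord0) :: tl by [].
have st : size tl = n'.*2.+1 by apply: succn_inj; exact: size_rim.
rewrite rimE; apply/andP; split; first by rewrite st /= odd_double.
rewrite altpath_rim.
have -> : rcons js ord0 = traject (@ordS n) (ordS ord0) n.
  rewrite trajectSr -iterSr; congr rcons.
  by apply: val_inj; apply/esym/(etrans (iter_ordS n)); rewrite modnn.
exact: fpath_traject.
Qed.

Lemma ncycles_delta_mul p :  matching setT p ->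
  ncycles (delta n * p) = (loops setT (delta n) p).*2.
Proof.
move=> mp; rewrite /loops setCT cards0 subn0 even_halfK //.
apply: (@even_ncycles _ _ (delta n)) => [x|].
  by rewrite (matchingK matching_delta) (matching_neq _ matching_delta) inE.
rewrite /rmulp mulgA (_ : (delta n * delta n = 1)%g) ?mul1g ?pairing_matching //.
by apply/permP=> x; rewrite permM perm1 (matchingK matching_delta).
Qed.

(** By [gammatE], [s^-1 \op gammat n] is conjugate to [epsilon * p] up to the
    order of the factors, which does not change the number of cycles. *)
Lemma ncycles_epsilon_mul p :  matching setT p ->
  ncycles ((delta n * p)^-1 \op gammat n) = (loops setT epsilon p).*2.
Proof.
move=> mp; have -> : ncycles ((delta n * p)^-1 \op gammat n) = ncycles (epsilon * p).
  rewrite /rmulp gammatE invMg /ncycles card_porbits_mulC (matchingV mp).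
  by rewrite -mulgA (mulgA (_^-1)%g) mulVg mul1g card_porbits_mulC.
rewrite /loops setCT cards0 subn0 even_halfK //.
apply: (@even_ncycles _ _ epsilon) => [x|].
  by rewrite (matchingK matching_epsilon) (matching_neq _ matching_epsilon) inE.
rewrite /rmulp mulgA -{1}(matchingV matching_epsilon) mulVg mul1g.
by rewrite pairing_matching.
Qed.

(** If [p] only joins positive to negative points, then [delta * p] is [alpha]
    on the negative and its inverse on the positive points for a permutation
    [alpha] of ['I_n], and [epsilon * p] is in the same way made of two copies of
    [S * alpha], where [S] is a cycle of length [n].  The numbers of cycles of
    [alpha] and [S * alpha] add up to [n + 1] modulo 2, by the multiplicativity
    of the signature. *)
Lemma orientable_loops p : matching setT p -> (forall b i, (p (b, i)).1 = ~~ b) ->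
  (loops setT (delta n) p + loops setT epsilon p)%N != n.
Proof.
move=> mp po; have pK := matchingK mp.
pose f b i := (p (b, i)).2.
have fE b i : p (b, i) = (~~ b, f b i).
  by rewrite /f -{1}(po b i); case: (p _).
have fK b : cancel (f b) (f (~~ b)).
  by move=> i; have := pK (b, i); rewrite !fE negbK => -[].
pose alpha : {perm 'I_n} := perm (can_inj (fK false)).
have alphaE i : alpha i = f false i by rewrite permE.
have alphaVE i : (alpha^-1)%g i = f true i.
  by apply: (@perm_inj _ alpha); rewrite permKV alphaE (fK true).
pose S : {perm 'I_n} := perm (@ordS_inj n).
have SE i : S i = ordS i by rewrite permE.
have SVE i : (S^-1)%g i = ord_pred i.
  by apply: (@perm_inj _ S); rewrite permKV SE ord_predK.
have cD : #|porbits (delta n * p)| = (#|porbits alpha|).*2.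
  rewrite (@card_porbits_bool _ _ (fun b => if b then alpha else (alpha^-1)%g)).
    by rewrite porbitsV addnn.
  by move=> [] i; rewrite permM deltaE fE /= ?alphaE ?alphaVE.
have cE : #|porbits (epsilon * p)| = (#|porbits (S * alpha)|).*2.
  rewrite (@card_porbits_bool _ _
    (fun b => if b then (S * alpha)%g else (S^-1 * alpha^-1)%g)).
    by rewrite -invMg porbitsV card_porbits_mulC addnn.
  by move=> [] i; rewrite (permM epsilon) epsilonE fE /= permM ?alphaE ?alphaVE ?SE ?SVE.
rewrite /loops setCT cards0 !subn0 cD cE !doubleK.
have cS : #|porbits S| = 1%N.
  rewrite (_ : porbits S = [set porbit S ord0]) ?cards1 //.
  apply/setP=> B; rewrite inE; apply/imsetP/eqP => [[i _ ->]|->]; last by exists ord0.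
  apply/eqP; rewrite eq_porbit_mem; apply/porbitP; exists i.
  rewrite permX {1}[i]ord_iter_ordS; apply: eq_iter => k; by rewrite SE.
have : odd_perm (S * alpha) = odd_perm S (+) odd_perm alpha by rewrite odd_permM.
have oI : odd #|{: 'I_n}| = odd n by rewrite card_ord.
rewrite /odd_perm cS oI => par; apply/eqP => /(congr1 odd); rewrite oddD => e.
by move: par; rewrite -e; do 2 case: (odd _).
Qed.

(** The positive and the negative points are orbits of [gammat n], and
    [delta * p] joins them as soon as [p] joins two points of the same sign. *)
Lemma projective_transitive p : matching setT p ->
  (loops setT (delta n) p + loops setT epsilon p)%N = n ->
  [transitive <<[set (delta n * p)%g; gammat n]>>, on [set: pm n] | 'P].
Proof.
move=> mp ln; pose G := <<[set (delta n * p)%g; gammat n]>>%G.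
rewrite -[<<_>>%g]/(gval G).
have sG : (delta n * p)%g \in G by apply: mem_gen; rewrite !inE eqxx.
have gG : gammat n \in G by apply: mem_gen; rewrite !inE eqxx orbT.
have step x g : g \in G -> orbit 'P G (g x) = orbit 'P G x.
  by move=> gG'; apply/orbit_eqP; apply: (mem_orbit 'P).
have side b i : orbit 'P G (b, i) = orbit 'P G (b, ord0).
  rewrite [i]ord_iter_ordS; elim: (nat_of_ord i) => //= k <-.
  case: b; last by rewrite -[RHS](step _ _ gG) gammat_app.
  by rewrite -[LHS](step _ _ gG) gammat_app ordSK.
have [/forallP po|] := boolP [forall x : pm n, (p x).1 == ~~ x.1].
  have : (loops setT (delta n) p + loops setT epsilon p)%N != n.
    by apply: orientable_loops => // b i; apply/eqP/(po (b, i)).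
  by rewrite ln eqxx.
case/forallPn=> -[b i] /= pbi.
have pE : p (b, i) = (b, (p (b, i)).2).
  by move: pbi; case: (p _) => b' j /=; case: b b' => -[].
have both : orbit 'P G (~~ b, ord0) = orbit 'P G (b, ord0).
  rewrite -(side (~~ b) i) -(side b (p (b, i)).2) -pE -(step _ _ sG) permM deltaE negbK.
  by [].
apply/imsetP; exists (b, ord0); first by rewrite inE.
apply/setP=> -[b' j]; rewrite inE; apply/esym/orbit_eqP; rewrite side.
by move: both; case: b b' {pbi pE} => -[].
Qed.

Lemma mem_SNCdelta p : ((delta n * p)%g \in SNCdelta n) =
  matching setT p && (loops setT (delta n) p + loops setT epsilon p == n)%N.
Proof.
rewrite inE {2}/rmulp mulgA (_ : (delta n * delta n = 1)%g); last first.
  by apply/permP=> x; rewrite permM perm1 (matchingK matching_delta).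
rewrite mul1g pairing_matching andbA andbC; case: (boolP (matching setT p)) => //= mp.
rewrite (ncycles_delta_mul mp) (ncycles_epsilon_mul mp) -doubleD mul2n.
rewrite (inj_eq double_inj); apply/andP/eqP => [[_ /eqP //]|e].
by rewrite e eqxx (projective_transitive mp e).
Qed.

Lemma ncdsum_coef (R : realFieldType) (c : R) :
  ncdsum c n = (loopgf (c%:P * 'X) 'X setT (delta n) epsilon)`_n.
Proof.
rewrite /ncdsum (reindex_inj (mulgI (delta n))) (eq_bigl _ _ mem_SNCdelta).
rewrite /loopgf coef_sum big_mkcondr /=; apply: eq_bigr => p mp.
rewrite (ncycles_delta_mul mp) doubleK exprMn -mulrA -exprD -polyC_exp coefCM coefXn.
by rewrite eq_sym; case: ifP => _; rewrite ?mulr1 ?mulr0.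
Qed.

End Annular.

(** * The recursion for non-crossing partitions *)

(** The words [s] in which [s_i] is the least element of the block of [i] in a
    non-crossing partition.  The second condition, with [j = s_l], makes
    [s_l] the least element of its own block; for other [j] between [s_l] and [l], it
    says that the block of [j] does not reach below [s_l]. *)
Definition ncword (s : seq nat) : Prop :=
  (forall i, i < size s -> nth 0 s i <= i)%N /\
  (forall j l, j <= l -> l < size s -> nth 0 s l <= j -> nth 0 s l <= nth 0 s j)%N.

(** The last letter of [ncjoin s t] is [size s]: a new last element is added to
    the block of the first element of [t], or forms a block on its own if [t] is
    empty, and the result is put to the right of [s]. *)
Definition ncjoin (s t : seq nat) : seq nat := s ++ map (addn (size s)) (rcons t 0%N).

Lemma size_ncjoin s t : size (ncjoin s t) = (size s + size t).+1.
Proof. by rewrite size_cat size_map size_rcons addnS. Qed.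

Lemma last_ncjoin s t : last 0%N (ncjoin s t) = size s.
Proof. by rewrite /ncjoin map_rcons last_cat last_rcons addn0. Qed.

Lemma nth_ncjoin_l s t i : (i < size s)%N -> nth 0%N (ncjoin s t) i = nth 0%N s i.
Proof. by move=> lt; rewrite nth_cat lt. Qed.

Lemma nth_ncjoin_r s t i : (i <= size t)%N ->
  nth 0%N (ncjoin s t) (size s + i) = (size s + nth 0%N t i)%N.
Proof.
move=> le; rewrite nth_cat ltnNge leq_addr /= addKn (nth_map 0%N) ?size_rcons //.
rewrite nth_rcons; case: ltngtP le => // -> _; first by rewrite nth_default.
Qed.

Lemma ncword_join s t : ncword s -> ncword t -> ncword (ncjoin s t).
Proof.
move=> [s1 s2] [t1 t2].
have t1' i : (nth 0 t i <= i)%N.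
  by case: (ltnP i (size t)) => [/t1//|?]; rewrite nth_default.
have t2' j l : (j <= l -> nth 0 t l <= j -> nth 0 t l <= nth 0 t j)%N.
  move=> jl; case: (ltnP l (size t)) => [lt|?]; first exact: t2.
  by rewrite nth_default.
split=> [i|j l jl]; rewrite size_ncjoin ltnS.
  case: (ltnP i (size s)) => [lt _|le]; first by rewrite nth_ncjoin_l ?s1.
  by rewrite -(subnKC le) leq_add2l => lei; rewrite nth_ncjoin_r // leq_add2l.
case: (ltnP l (size s)) => [lt _|le].
  by rewrite !nth_ncjoin_l ?(leq_ltn_trans jl) //; apply: s2.
rewrite -(subnKC le) leq_add2l => lel; rewrite nth_ncjoin_r //.
case: (ltnP j (size s)) => [ltj h|lej].
  by have := leq_trans (leq_addr _ _) h; rewrite leqNgt ltj.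
have jl' : (j - size s <= l - size s)%N by rewrite leq_sub2r.
rewrite -(subnKC lej) leq_add2l nth_ncjoin_r ?(leq_trans jl') // leq_add2l.
exact: t2'.
Qed.

(** If the block of the last element [n] begins at [j], then no element
    from [j] on is in a block that begins before [j], and the word splits at [j]. *)
Lemma ncword_split n u : ncword u -> size u = n.+1 ->
  let j := last 0%N u in
  (j <= n)%N /\ exists s t, [/\ ncword s, ncword t, size s = j, size t = (n - j)%N
    & u = ncjoin s t].
Proof.
move=> [u1 u2] su j.
have jE : j = nth 0%N u n by rewrite /j -nth_last su.
have lej : (j <= n)%N by rewrite jE u1 ?su.
split=> //.
pose s := take j u; pose t := [seq (x - j)%N | x <- take (n - j) (drop j u)].
have ss : size s = j by rewrite size_takel // su ltnW.
have st : size t = (n - j)%N by rewrite size_map size_takel // size_drop su leq_sub2r.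
have ns i : (i < j)%N -> nth 0%N s i = nth 0%N u i by move=> ?; rewrite nth_take.
have nt i : (i < n - j)%N -> nth 0%N t i = (nth 0%N u (j + i) - j)%N.
  by move=> lti; rewrite (nth_map 0%N) ?nth_take ?nth_drop // -(size_map (subn^~ j)) st.
have uj k : (j <= k)%N -> (k <= n)%N -> (j <= nth 0 u k)%N.
  by move=> jk kn; rewrite jE; apply: u2; rewrite ?su -?jE.
exists s, t; split=> //.
- split=> [i|i l il]; rewrite ss => lt; rewrite !ns ?(leq_ltn_trans il) //.
    by apply: u1; rewrite su; lia.
  by apply: u2 => //; rewrite su; lia.
- split=> [i|i l il]; rewrite st => lt; rewrite !nt ?(leq_ltn_trans il) //.
    by rewrite leq_subLR; apply: u1; rewrite su; lia.
  rewrite leq_subLR => h; apply: leq_sub2r; apply: u2 => //.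
    by rewrite leq_add2l.
  by rewrite su; lia.
apply: (@eq_from_nth _ 0%N) => [|i].
  by rewrite size_ncjoin ss st su subnKC.
rewrite su ltnS => lei.
case: (ltnP i j) => [lt|le]; first by rewrite nth_ncjoin_l ?ss ?ns.
have [ltn|ein] : (i < n)%N \/ i = n by lia.
  have := @nth_ncjoin_r s t (i - j); rewrite ss st subnKC // => ->; last first.
    by rewrite leq_sub2r.
  by rewrite nt ?subnKC ?uj //; lia.
rewrite ein; have := @nth_ncjoin_r s t (n - j); rewrite ss st subnKC // => -> //.
by rewrite -jE nth_default ?addn0 // st.
Qed.

(** The number of blocks, each being counted at its least element. *)
Definition nmin (s : seq nat) : nat := (\sum_(0 <= i < size s) (nth 0 s i == i))%N.

Lemma nmin_join s t : nmin (ncjoin s t) = (nmin s + (nmin t + nilp t))%N.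
Proof.
rewrite /nmin size_ncjoin (@big_cat_nat _ _ _ (size s)) /=; first last.
- by rewrite -addnS leq_addr.
- by [].
congr (_ + _)%N.
  by apply: eq_big_nat => i /= lt; rewrite nth_ncjoin_l.
rewrite -{1}[size s]add0n big_addn -addnS addKn big_nat_recr //=; congr (_ + _)%N.
  apply: eq_big_nat => i /= lt; rewrite addnC nth_ncjoin_r ?(ltnW lt) //.
  by rewrite eqn_add2l.
by rewrite addnC nth_ncjoin_r // eqn_add2l nth_default // eq_sym.
Qed.

Section Words.
Variable n : nat.
Implicit Types (P : {set {set 'I_n}}) (i j k l : 'I_n).

Definition blockmin P i : 'I_n := [arg min_(k < i | k \in pblock P i) k].

Definition ncword_of P : seq nat := [seq val (blockmin P i) | i <- enum 'I_n].

Lemma size_ncword_of P : size (ncword_of P) = n.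
Proof. by rewrite size_map size_enum_ord. Qed.

Lemma nth_ncword_of P i : nth 0%N (ncword_of P) i = blockmin P i.
Proof. by rewrite (nth_map i) ?nth_ord_enum // size_enum_ord. Qed.

Section Partition.
Variable P : {set {set 'I_n}}.
Hypothesis partP : partition P [set: 'I_n].

Let mem_block i : i \in pblock P i.
Proof. by rewrite mem_pblock (cover_partition partP) inE. Qed.

Let trivP : trivIset P. Proof. by case/and3P: partP. Qed.

Lemma blockmin_spec i :
  blockmin P i \in pblock P i /\ forall k, k \in pblock P i -> (blockmin P i <= k)%N.
Proof. by rewrite /blockmin; case: arg_minnP. Qed.

Lemma eq_blockmin i j : (blockmin P i == blockmin P j) = (pblock P i == pblock P j).
Proof.
have [mi li] := blockmin_spec i; have [mj lj] := blockmin_spec j.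
apply/eqP/eqP=> e.
  by rewrite -(same_pblock trivP mi) e (same_pblock trivP mj).
by apply/val_inj/eqP; rewrite eqn_leq /= li ?e // lj // -e.
Qed.

Lemma blockmin_id i : blockmin P (blockmin P i) = blockmin P i.
Proof.
have [mi _] := blockmin_spec i; apply/eqP.
by rewrite eq_blockmin (same_pblock trivP mi).
Qed.

Lemma blockmin_le i : (blockmin P i <= i)%N.
Proof. by have [_] := blockmin_spec i; apply. Qed.

(** The word determines the partition, hence [ncword_of] is injective. *)
Lemma partition_ncword_of :
  preim_partition (fun i : 'I_n => nth 0%N (ncword_of P) i) [set: 'I_n] = P.
Proof.
rewrite -[RHS](preim_partition_pblock partP); apply: eq_in_imset => i _.
apply/setP=> j; rewrite !inE /= !nth_ncword_of.
by rewrite (inj_eq val_inj) eq_blockmin.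
Qed.

Lemma nmin_ncword_of : nmin (ncword_of P) = #|P|.
Proof.
rewrite /nmin size_ncword_of big_mkord.
have -> : #|P| = #|[pred i | blockmin P i == i]|; last first.
  rewrite -sum1_card [RHS]big_mkcond; apply: eq_bigr => i _.
  by rewrite nth_ncword_of inE (inj_eq val_inj); case: eqP.
have {1}-> : P = [set pblock P i | i in [pred i | blockmin P i == i]].
  apply/setP=> B; apply/idP/imsetP => [BP|[i _ ->]].
    have /set0Pn[i iB] : B != set0 by apply: contraTneq BP => ->; case/and3P: partP.
    exists (blockmin P i); first by rewrite inE blockmin_id.
    rewrite -(def_pblock trivP BP iB); apply/esym/same_pblock => //.
    by have [] := blockmin_spec i.
  by rewrite pblock_mem // (cover_partition partP) inE.
rewrite card_in_imset // => i j; rewrite !inE => /eqP di /eqP dj e.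
by rewrite -di -dj; apply/eqP; rewrite eq_blockmin e.
Qed.

Lemma ncword_of_ncword : noncrossing P -> ncword (ncword_of P).
Proof.
move=> ncP; split=> [i|j l jl]; rewrite size_ncword_of => lt.
  by have := blockmin_le (Ordinal lt); rewrite -nth_ncword_of.
pose L := Ordinal lt; pose J := Ordinal (leq_ltn_trans jl lt).
rewrite -[nth _ _ l]/(nth 0%N _ (L : nat)) -[nth _ _ j]/(nth 0%N _ (J : nat)).
rewrite !nth_ncword_of => bj; rewrite leqNgt; apply/negP => lt_min.
have nJL : blockmin P J != blockmin P L.
  by apply: contraTneq lt_min => ->; rewrite ltnn.
have [mJ _] := blockmin_spec J; have [mL _] := blockmin_spec L.
have blt : (blockmin P L < j)%N.
  rewrite ltn_neqAle bj andbT; apply: contra nJL => /eqP e.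
  by rewrite -(blockmin_id L); apply/eqP; congr blockmin; apply: val_inj.
have jlt : (j < l)%N.
  rewrite ltn_neqAle jl andbT; apply: contra nJL => /eqP e.
  by apply/eqP; congr blockmin; apply: val_inj.
have pJ : pblock P J \in P by rewrite pblock_mem // (cover_partition partP) inE.
have pL : pblock P L \in P by rewrite pblock_mem // (cover_partition partP) inE.
case/negP: nJL; rewrite eq_blockmin.
apply: (implyP (forall_inP (forall_inP ncP _ pJ) _ pL)).
apply/exists_inP; exists (blockmin P J) => //.
apply/exists_inP; exists (blockmin P L) => //.
apply/exists_inP; exists J; rewrite ?mem_block //.
by apply/exists_inP; exists L; rewrite ?mem_block // lt_min blt.
Qed.

End Partition.

Lemma ncword_surj s : ncword s -> size s = n -> exists2 P, P \in NC n & ncword_of P = s.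
Proof.
move=> [s1 s2] ss; pose f (i : 'I_n) := nth 0%N s i.
pose P := preim_partition f [set: 'I_n].
have partP : partition P [set: 'I_n] by apply: preim_partitionP.
have pbP i j : (j \in pblock P i) = (f i == f j).
  have eqR : {in [set: 'I_n] & &, equivalence_rel [rel x y | f x == f y]}.
    by move=> x y z _ _ _; split=> //= /eqP->.
  exact: (pblock_equivalence_partition eqR (in_setT i) (in_setT j)).
have lef (i : 'I_n) : (f i <= i)%N by rewrite s1 ?ss.
have fid (i : 'I_n) : nth 0%N s (f i) = f i.
  apply/eqP; rewrite eqn_leq s1 ?ss ?(leq_ltn_trans (lef i)) //.
  by rewrite (s2 (f i) i) ?ss.
have noncP : noncrossing P.
  apply/forall_inP=> B BP; apply/forall_inP => C CP; apply/implyP.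
  case/exists_inP=> i iB /exists_inP[j jC /exists_inP[k kB /exists_inP[l lC]]].
  case/and3P=> ij jk kl; have /and3P[_ trivP _] := partP.
  have BE := def_pblock trivP BP iB; have CE := def_pblock trivP CP jC.
  rewrite -BE -CE; apply/eqP/same_pblock => //.
  rewrite pbP; move: kB lC; rewrite -BE -CE !pbP => /eqP fik /eqP fjl.
  have h1 : (f j <= f k)%N.
    by rewrite fjl; apply: s2; rewrite ?ss ?(ltnW kl) // -/(f l) -fjl (leq_trans (lef j)) // ltnW.
  have h2 : (f k <= f j)%N.
    by apply: s2; rewrite ?ss ?(ltnW jk) // -/(f k) -fik (leq_trans (lef i)) // ltnW.
  by rewrite fik eqn_leq h1 h2.
exists P; first by rewrite inE partP.
apply: (@eq_from_nth _ 0%N) => [|i]; rewrite size_ncword_of ?ss // => lti.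
have -> : i = Ordinal lti by [].
rewrite nth_ncword_of; have [mi li] := blockmin_spec partP (Ordinal lti).
move: mi; rewrite pbP => /eqP fi; apply/eqP; rewrite eqn_leq.
have ltf : (f (Ordinal lti) < n)%N by apply: (leq_ltn_trans (lef (Ordinal lti))).
rewrite (li (Ordinal ltf)) /=; last by rewrite pbP -{1}(fid (Ordinal lti)).
by rewrite -/(f (Ordinal lti)) fi lef.
Qed.

Definition ncwords : seq (seq nat) := [seq ncword_of P | P <- enum (NC n)].

Lemma mem_ncwords s : s \in ncwords <-> ncword s /\ size s = n.
Proof.
split=> [/mapP[P]|[ncs ss]].
  rewrite mem_enum inE => /andP[partP ncP] ->; rewrite size_ncword_of.
  by split=> //; apply: ncword_of_ncword.
by have [P PN <-] := ncword_surj ncs ss; rewrite map_f ?mem_enum.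
Qed.

Lemma uniq_ncwords : uniq ncwords.
Proof.
rewrite map_inj_in_uniq ?enum_uniq // => P1 P2; rewrite !mem_enum !inE.
move=> /andP[part1 _] /andP[part2 _] e.
by rewrite -(partition_ncword_of part1) -(partition_ncword_of part2) e.
Qed.

Lemma ncsum_ncwords (R : realFieldType) (c : R) :
  ncsum c n = \sum_(s <- ncwords) c ^+ nmin s.
Proof.
rewrite big_map big_enum; apply: eq_bigr => P; rewrite inE => /andP[partP _].
by rewrite nmin_ncword_of.
Qed.

End Words.

(** A non-crossing partition of [n + 1] points is [ncjoin s t] for unique [s]
    and [t], and has one block more than [s] and [t] together if [t] is empty. *)
Lemma ncsumS (R : realFieldType) (c : R) n :
  ncsum c n.+1 = \sum_(k < n.+1) c ^+ (k == 0%N :> nat) * ncsum c k * ncsum c (n - k).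
Proof.
rewrite ncsum_ncwords (reindex_inj rev_ord_inj) /=.
rewrite (partition_big (fun s => inord (last 0%N s) : 'I_n.+1) predT) //=.
apply: eq_bigr => j _; have lej : (j <= n)%N by rewrite -ltnS.
rewrite subSS subKn //; set W := ncwords n.+1.
have inW u : u \in W -> (inord (last 0%N u) == j) = (last 0%N u == j).
  case/mem_ncwords=> ncu su; have [lel _] := ncword_split ncu su.
  by rewrite -val_eqE /= inordK.
have -> : \sum_(s <- W | inord (last 0%N s) == j) c ^+ nmin s =
  \sum_(u <- [seq ncjoin s t | s <- ncwords j, t <- ncwords (n - j)]) c ^+ nmin u.
  rewrite -big_filter; apply: perm_big; apply: uniq_perm.
  - by rewrite filter_uniq ?uniq_ncwords.
  - apply: allpairs_uniq; rewrite ?uniq_ncwords // => p1 p2.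
    case/allpairsP=> -[s1 t1] /= [/mem_ncwords[_ s1j] _ ->].
    case/allpairsP=> -[s2 t2] /= [/mem_ncwords[_ s2j] _ ->].
    rewrite /ncjoin /= s1j s2j => /eqP; rewrite eqseq_cat ?s1j ?s2j // => /andP[/eqP-> /eqP].
    by move=> /(inj_map (@addnI j)) /rcons_inj[->].
  move=> u; rewrite mem_filter; apply/andP/allpairsP.
    case=> uj uW; move: uj; rewrite inW // => /eqP uj.
    case/mem_ncwords: uW => ncu su; have [_ [s [t [ncs nct ss st ->]]]] := ncword_split ncu su.
    exists (s, t); split=> //=; apply/mem_ncwords; split=> //; rewrite -uj //.
  case=> -[s t] /= [/mem_ncwords[ncs ss] /mem_ncwords[nct st] ->].
  have sW : ncjoin s t \in W.
    apply/mem_ncwords; split; first exact: ncword_join.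
    by rewrite size_ncjoin ss st subnKC.
  by rewrite inW // last_ncjoin ss.
rewrite big_allpairs_dep /= [ncsum c j]ncsum_ncwords [ncsum c (n - j)%N]ncsum_ncwords.
rewrite mulr_sumr; apply: eq_big_seq => s /mem_ncwords[_ ss].
rewrite mulrAC mulr_sumr; apply: eq_big_seq => t /mem_ncwords[_ st].
rewrite nmin_join /nilp st !exprD; ring.
Qed.

(** * The annular recursion *)

Section Recursion.
Variables (R : realFieldType) (c : R) (M : nat -> {poly R}).
Hypothesis momM : is_moments c M.

Lemma ncsum_moment n : ncsum c n = (M n)`_0.
Proof.
have [M0 MS] := momM.
elim/ltn_ind: n => -[_|n IHn]; first by rewrite ncsum0 M0 coef1.
rewrite ncsumS MS coefD -polyC_natr coefCM coefXM mulr0 add0r coef_sum.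
apply: eq_bigr => k _; rewrite -polyC_exp !coef0M coefC /=.
by rewrite !IHn // ltnS ?leq_subr // -ltnS.
Qed.

Lemma ncdsum_moment n : ncdsum c n.+1 = (M n.+1)`_1.
Proof.
rewrite ncdsum_coef; have := loopgf_topcoef momM (system_rim n).
rewrite /weight !big_seq1 size_rim doubleK addn1 => /topcoef_coef ->.
by [].
Qed.

Lemma moment_coef1S n : (M n.+1)`_1 = n%:R * (M n)`_0 +
  \sum_(k < n.+1) c ^+ (k == 0%N :> nat) *
     ((M k)`_0 * (M (n - k)%N)`_1 + (M k)`_1 * (M (n - k)%N)`_0).
Proof.
rewrite (proj2 momM) coefD -polyC_natr coefCM coefXM coef_sum; congr (_ + _).
apply: eq_bigr => k _; rewrite -polyC_exp -mulrA coefCM coefM.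
by rewrite !big_ord_recl big_ord0 addr0.
Qed.

End Recursion.

Theorem theorem42 (R : realFieldType) (c : R) (hc : 0 < c) :
  ncdsum c 1 = 0 /\
  forall n : nat, (2 <= n)%N ->
    ncdsum c n =
      (n - 1)%:R * ncsum c (n - 1) + (c - 1) * ncdsum c (n - 1)
      + 2%:R * \sum_(1 <= k < (n - 2).+1) ncsum c (k - 1) * ncdsum c (n - k).
Proof.
have [M momM] := exists_moments c.
have M0 := proj1 momM.
have M01 : (M 0%N)`_1 = 0 by rewrite M0 coef1.
have M11 : (M 1%N)`_1 = 0.
  by rewrite (moment_coef1S momM) big_ord1 mul0r add0r M01 mulr0 mul0r addr0 mulr0.
split; first by rewrite (ncdsum_moment momM).
case=> [|[|n]] // _; rewrite !subSS !subn0.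
rewrite !(ncdsum_moment momM) (ncsum_moment momM) (moment_coef1S momM) -addrA.
congr (_ + _).
pose S := \sum_(0 <= k < n.+1) (M k)`_0 * (M (n.+1 - k)%N)`_1.
have -> : \sum_(1 <= k < n.+1) ncsum c (k - 1) * ncdsum c (n.+2 - k) = S.
  rewrite /S [RHS]big_nat_recr //= subSnn M11 mulr0 addr0 big_add1 /=.
  apply: eq_big_nat => k /andP[_ lt].
  rewrite subSS subn0 subSS (ncsum_moment momM) subSn; last exact: ltnW.
  by rewrite (ncdsum_moment momM).
rewrite big_ord_recl /= expr1 subn0 M01 M0 coef1 mul1r mul0r addr0.
(* For [k > 0] each half of the product rule gives [S]: one without its term
   [M 0 * M (n + 1)], the other in reversed order. *)
have -> : \sum_(i < n.+1) c ^+ (bump 0 i == 0%N) *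
     ((M (bump 0 i))`_0 * (M (n.+1 - bump 0 i)%N)`_1 +
      (M (bump 0 i))`_1 * (M (n.+1 - bump 0 i)%N)`_0) = (S - (M n.+1)`_1) + S.
  under eq_bigr => i _ do rewrite /bump /= add1n subSS mul1r.
  rewrite big_split /=; congr (_ + _).
    rewrite /S big_nat_recl // subn0 M0 coef1 mul1r addrC addKr.
    rewrite big_ord_recr /= subnn M01 mulr0 addr0.
    rewrite -(big_mkord predT (fun i => (M i.+1)`_0 * (M (n - i)%N)`_1)).
    by apply: eq_big_nat => k _; rewrite subSS.
  rewrite /S big_mkord (reindex_inj rev_ord_inj) /=.
  apply: eq_bigr => i _; have lei : (i <= n)%N by rewrite -ltnS.
  by rewrite subSS subKn // -subSn // mulrC.
ring.
Qed.
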